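(* Let $m$ be a positive integer and let $M$ be a nonempty subset of $\{1, \ldots, m\}$. For each integer $n \ge 0$ let $a(n)$ be the number of $n$-color compositions of $n$ in which every color $c$ satisfies $c \equiv r \pmod m$ for some $r \in M$, and set $a(n) = 0$ for $n \le -1$. Let $M' = M$ if $1 \notin M$ and $M' = M \cup \{m+1\}$ if $1 \in M$. Then for $0 \le n \le m+1$, $a(n)$ equals the number of $n$-color compositions of $n$ all of whose colors lie in $M'$, and for every integer $n \ge m+2$, \[ a(n) = a(n-1) + a(n-m) - a(n-m-1) + \sum_{r \in M} a(n-r). \]
   Context: An $n$-color composition of a positive integer $n$ is a finite sequence of parts $(\kappa^{(1)}_{c_1}, \ldots, \kappa^{(r)}_{c_r})$, where $\kappa^{(1)}, \ldots, \kappa^{(r)}$ are positive integers with sum $n$ and each part $\kappa^{(j)}$ carries a color $c_j \in \{1, \ldots, \kappa^{(j)}\}$; two such compositions are the same iff they have the same sequence of (part, color) pairs. By convention there is exactly one (empty) composition of $0$. *)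

(* Defs.v *)
From HB Require Import structures.
From mathcomp Require Import all_boot all_order all_algebra finmap.

Set Implicit Arguments.
Unset Strict Implicit.
Unset Printing Implicit Defensive.

Import GRing.Theory.

Local Open Scope fset_scope.
Local Open Scope nat_scope.

(* A pair [(k, c)] is the part [k] with color [c]. *)
Definition is_ncolor_comp (n : nat) (s : seq (nat * nat)) : bool :=
  all (fun p => (0 < p.1) && (1 <= p.2 <= p.1)) s && (sumn (unzip1 s) == n).

(* A composition of [n] has at most [n] parts, with parts and colors at most   *)
(* [n]: enumerating the sequences within these bounds loses nothing, as        *)
(* [in_ncolor_comps] shows.                                                    *)
Definition ncolor_comps (n : nat) : {fset seq (nat * nat)} :=
  [fset s in [seq [seq (val p.1, val p.2) | p <- t]
             | t : n.-bseq ('I_n.+1 * 'I_n.+1)] | is_ncolor_comp n s].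

Lemma in_ncolor_comps (n : nat) (s : seq (nat * nat)) :
  (s \in ncolor_comps n) = is_ncolor_comp n s.
Proof.
rewrite !inE /=; apply: andb_idl => /andP[/allP sP /eqP sn].
have le_n p : p \in s -> p.1 <= n.
  move=> ps; rewrite -sn sumnE.
  by rewrite (big_rem p.1) ?leq_addr //; apply/mapP; exists p.
have size_s : size s <= n.
  rewrite -sn -(size_map fst) sumnE -sum1_size big_seq [leqRHS]big_seq.
  by apply: leq_sum => k /mapP[p /sP /andP[? _] ->].
pose t := [seq (inord p.1, inord p.2) : 'I_n.+1 * 'I_n.+1 | p <- s].
have size_t : size t <= n by rewrite size_map.
apply/imageP; exists (Bseq size_t) => //=; rewrite -map_comp -[LHS]map_id.
apply/eq_in_map => -[k c] ps /=; have := le_n _ ps => /= kn.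
have /andP[_ /andP[_ ck]] := sP _ ps.
by rewrite !inordK // ltnS (leq_trans ck).
Qed.

Definition ncolor_count (C : pred nat) (n : nat) : nat :=
  #|` [fset s in ncolor_comps n | all (fun p => C p.2) s]|.

Definition color_mod (m : nat) (M : {fset nat}) : pred nat :=
  fun c => has (fun r => c == r %[mod m]) M.

Definition a (m : nat) (M : {fset nat}) (n : int) : int :=
  match n with
  | Posz k => Posz (ncolor_count (color_mod m M) k)
  | Negz _ => 0%R
  end.

Definition Mprime (m : nat) (M : {fset nat}) : {fset nat} :=
  if 1 \in M then m.+1 |` M else M.

(* Main.v *)
Require Import Defs.
From mathcomp Require Import all_boot all_order all_algebra finmap.
From mathcomp Require Import zify.

(* Let b n be the number of n-color compositions of n with all colors in C and  *)
(* w k the number of colors c <= k in C.  Removing the first part gives         *)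
(* b n = \sum_(1 <= k <= n) w k * b (n - k) for n > 0.  Taking the difference   *)
(* in n replaces w by the indicator function of C, and when C is m-periodic     *)
(* the difference with step m of that sum only leaves the colors c <= m.        *)

Import Order.TTheory GRing.Theory Num.Theory.

Local Open Scope fset_scope.
Local Open Scope ring_scope.

(** The convolution is [ncolor_countS], its difference [ncolor_countSS], and the step-m difference
    [ncolor_count_periodic]; [sum_color_mod] turns the remaining sum over one period into a sum over
    [M]. As b 0 = 1 does not come from the convolution, the first difference holds only from index 2
    on; it is used at n and at n - m, whence n >= m + 2. For n <= m + 1 only colors up to m + 1
    occur, and among these the admissible ones form [Mprime m M] ([color_mod_Mprime]). *)

Lemma card_fset_uniq (T : choiceType) (A : {fset T}) (s : seq T) :
  uniq s -> A =i s -> #|` A| = size s.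
Proof. by move=> us As; apply/perm_size/uniq_perm. Qed.

Lemma in_ncolor_comps_sub (C : pred nat) (n : nat) (s : seq (nat * nat)) :
  (s \in [fset s in ncolor_comps n | all (fun p => C p.2) s]) =
  is_ncolor_comp n s && all (fun p => C p.2) s.
Proof. by rewrite in_fset inE /= in_ncolor_comps. Qed.

Section NcolorCount.
Local Open Scope nat_scope.
Variable C : pred nat.

Local Notation b := (ncolor_count C).
Local Notation comps n :=
  [fset s in ncolor_comps n | all (fun p => C p.2) s].

Lemma is_ncolor_comp_cons (n k c : nat) (s : seq (nat * nat)) :
  is_ncolor_comp n ((k, c) :: s) =
  [&& 0 < k <= n, 0 < c <= k & is_ncolor_comp (n - k) s].
Proof.
rewrite /is_ncolor_comp /=; case: (all _ s); rewrite ?andbT ?andbF ?andFb //=.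
by apply/idP/idP; lia.
Qed.

(** A color is bounded by its part, and a part by the total n. *)
Lemma ncolor_count_eq (D : pred nat) (n : nat) :
  (forall c, 0 < c <= n -> C c = D c) -> b n = ncolor_count D n.
Proof.
move=> CD; congr #|` _|; apply/fsetP=> s; rewrite !in_ncolor_comps_sub.
apply: andb_id2l => /andP[/allP sP /eqP sn].
apply: eq_in_all => p ps; apply: CD; have /and3P[_ -> pp] := sP p ps.
apply: leq_trans pp _; rewrite -sn sumnE.
by rewrite (big_rem p.1) ?leq_addr //; apply/mapP; exists p.
Qed.

Lemma ncolor_countS (n : nat) :
  b n.+1 = \sum_(k < n.+1) count C (iota 1 k.+1) * b (n - k).
Proof.
(* The possible first parts, with their admissible colors. *)
pose parts := [seq (k, c) | k <- iota 1 n.+1, c <- [seq c <- iota 1 k | C c]].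
have mem_parts k c : ((k, c) \in parts) = [&& 0 < k <= n.+1, 0 < c <= k & C c].
  apply/allpairsPdep/idP => [[k' [c' [+ + [-> ->]]]]|/and3P[kn ck Cc]].
    by rewrite mem_filter !mem_iota; lia.
  by exists k, c; rewrite mem_filter !mem_iota Cc; split=> //; lia.
have uniq_parts : uniq parts.
  apply: allpairs_uniq_dep => [|k _|]; rewrite ?filter_uniq ?iota_uniq //.
  by move=> [k c] [k' c'] _ _ /= [-> ->].
rewrite /ncolor_count.
(* A composition of a positive integer is uniquely a first part followed by a composition of the
   rest. *)
rewrite (card_fset_uniq _ _ [seq p :: t | p <- parts, t <- comps (n.+1 - p.1)]).
- rewrite size_allpairs_dep sumnE big_map /parts big_allpairs_dep.
  rewrite -[iota 1 n.+1]/(index_iota 1 n.+2) big_add1 big_mkord.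
  apply: eq_bigr => k _; rewrite -size_filter /= subSS.
  by rewrite big_const_seq iter_addn_0 count_predT mulnC.
- apply: allpairs_uniq_dep => // [p _|]; first exact: fset_uniq.
  by move=> [p t] [p' t'] _ _ /= [-> ->].
- move=> s; rewrite in_ncolor_comps_sub; apply/idP/allpairsPdep => /=.
    case: s => [|[k c] s]; first by rewrite /is_ncolor_comp.
    rewrite is_ncolor_comp_cons /= => /andP[/and3P[kn ck sP] /andP[Cc sC]].
    exists (k, c), s; rewrite mem_parts kn ck Cc; split=> //.
    by rewrite in_ncolor_comps_sub sP.
  move=> [[k c] [t [+ + ->]]]; rewrite mem_parts in_ncolor_comps_sub.
  by rewrite is_ncolor_comp_cons /= => /and3P[-> -> ->] /andP[-> ->].
Qed.

Lemma ncolor_countSS (n : nat) :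
  b n.+2 = b n.+1 + \sum_(c < n.+2) C c.+1 * b (n.+1 - c).
Proof.
rewrite ncolor_countS.
(* Separate the top color k + 1 from the colors up to k. The latter give b (n + 1) after a shift of
   k, the term k = 0 being zero. *)
under eq_bigr => k _ do rewrite -[k.+1]addn1 iotaD count_cat /= addn0 mulnDl.
by rewrite big_split; congr addn; rewrite big_ord_recl ncolor_countS.
Qed.

(** By periodicity, the colors above m in the difference at n + m + 2 contribute exactly the
    difference at n + 2. The identity is kept additive because subtraction on [nat] truncates. *)
Lemma ncolor_count_periodic (m n : nat) :
  (forall c, 0 < c -> C (m + c) = C c) ->
  b (n + m).+2 + b n.+1 =
  b (n + m).+1 + b n.+2 + \sum_(c < m) C c.+1 * b ((n + m).+1 - c).
Proof.
move=> Cm; rewrite !ncolor_countSS -(addSn n.+1) -addSn (addnC n.+2) big_split_ord.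
rewrite /= (eq_bigr (fun c : 'I_n.+2 => C c.+1 * b (n.+1 - c))) => [|c _]; first lia.
by rewrite -addnS Cm // addnC subnDl.
Qed.

End NcolorCount.

Section ColorMod.
Local Open Scope nat_scope.
Variables (m : nat) (M : {fset nat}).
Hypothesis M_range : forall r : nat, r \in M -> 1 <= r <= m.

Lemma color_modD (c : nat) : color_mod m M (m + c) = color_mod m M c.
Proof. by apply: eq_has => r /=; rewrite modnDl. Qed.

Lemma color_modE (c : nat) : 0 < c <= m -> color_mod m M c = (c \in M).
Proof.
case: c => // c cm; apply/hasP/idP => [[[|r] rM]|cM]; last by exists c.+1.
  by have := M_range _ rM.
have rm := M_range _ rM.
(* Lowering both representatives by 1 moves them from 1..m to 0..m-1, where congruence is
   equality. *)
by rewrite -(add1n c) -(add1n r) eqn_modDl !modn_small // => /eqP->.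
Qed.

Lemma color_mod_Mprime (c : nat) :
  0 < m -> 0 < c <= m.+1 -> color_mod m M c = (c \in Mprime m M).
Proof.
move=> m0 /andP[c0]; rewrite leq_eqVlt /Mprime => /orP[/eqP->|cm].
  (* The color m + 1 is admissible exactly when 1 is. *)
  rewrite -addn1 color_modD color_modE //.
  case: ifP => [_|]; first by rewrite addn1 !inE eqxx.
  by move=> _; apply/esym/negP => /M_range; lia.
rewrite color_modE ?c0 //; case: ifP => // _; rewrite !inE.
by have /negPf-> : c != m.+1 by lia.
Qed.

Lemma sum_color_mod (f : nat -> nat) :
  \sum_(c < m) color_mod m M c.+1 * f c = \sum_(r <- M) f r.-1.
Proof.
rewrite (perm_big [seq c <- iota 1 m | c \in M]) /=; last first.
  apply: uniq_perm; rewrite ?filter_uniq ?iota_uniq ?fset_uniq // => r.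
  rewrite mem_filter mem_iota; apply/esym/andb_idr => /M_range; lia.
rewrite big_filter -[m in iota 1 m](subn1 m.+1) big_add1 big_mkord.
rewrite [RHS]big_mkcond; apply: eq_bigr => c _.
by rewrite color_modE ?ltn_ord //; case: ifP => _; rewrite ?mul1n ?mul0n.
Qed.

End ColorMod.

Theorem theorem3 (m : nat) (M : {fset nat})
    (m_gt0 : (0 < m)%N)
    (M_neq0 : M != fset0)
    (M_range : forall r : nat, r \in M -> (1 <= r <= m)%N) :
  (forall n : nat, (n <= m + 1)%N ->
     a m M n%:Z = (ncolor_count (fun c : nat => c \in Mprime m M) n)%:Z) /\
  (forall n : int, m%:Z + 2 <= n ->
     a m M n = a m M (n - 1) + a m M (n - m%:Z) - a m M (n - m%:Z - 1)
               + \sum_(r <- M) a m M (n - r%:Z)).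
Proof.
split=> [n nm|n nm].
  congr Posz; apply: ncolor_count_eq => c cn.
  by apply: color_mod_Mprime => //; lia.
have [k ->] : exists k : nat, n = (k + m).+2%:Z.
  by exists (`|n|%N - m - 2)%N; lia.
have -> : (k + m).+2%:Z - 1 = (k + m).+1%:Z by lia.
have -> : (k + m).+2%:Z - m%:Z = k.+2%:Z by lia.
have -> : k.+2%:Z - 1 = k.+1%:Z by lia.
(* Since 1 <= r <= m, neither the predecessor nor the subtraction on [nat] truncates. *)
have -> : \sum_(r <- M) a m M ((k + m).+2%:Z - r%:Z) =
    (\sum_(r <- M) ncolor_count (color_mod m M) ((k + m).+1 - r.-1))%N%:Z.
  rewrite (big_morph Posz PoszD (erefl _)) big_seq [RHS]big_seq.
  apply: eq_bigr => r /M_range rm.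
  by have -> : (k + m).+2%:Z - r%:Z = ((k + m).+1 - r.-1)%N%:Z by lia.
rewrite -(sum_color_mod _ _ M_range (fun c => ncolor_count _ (_ - c)%N)) /=.
have := ncolor_count_periodic (color_mod m M) m k (fun c _ => color_modD m M c).
by move: (\sum_(c < m) _)%N => S; lia.
Qed.
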